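(* There exists a complete family of at most $n$ optimal solutions of $(D)$, where $n$ is the number of variables of the constraint.
   Context: Setting. $X_1,\dots,X_n$ are variables with finite domains $D(X_i)\subset\mathbb{Z}$, and $C$ is a constraint on them, i.e. a set of allowed tuples. A support for $C$ is an allowed tuple $\langle a_1,\dots,a_n\rangle$ with $a_i\in D(X_i)$ for all $i$. $B=\{ij : 1\le i\le n,\ j\in D(X_i)\}$ is the (finite) set of variable/value pairs, where $ij$ is short for $(i,j)$. The characteristic vector of a support is $x\in\{0,1\}^{B}$ with $x_{ij}=1$ iff $a_i=j$; $\mathcal{S}$ is the set of characteristic vectors of the supports of $C$. Each pair has a cost $c_{ij}\in\mathbb{Z}$. Ideal formulation (standing assumption): $A$ is a real $m\times|B|$ matrix (with columns $A_{ij}$, $ij\in B$) and $b\in\mathbb{R}^m$ are such that $\{x\in\mathbb{R}^{B}_+ : Ax\ge b\}=\mathrm{conv}(\mathcal{S})$. $(P)$: $z^*=\min\{cx : Ax\ge b,\ x\in\mathbb{R}^B_+\}$; $(D)$: $\max\{ub : uA\le c,\ u\in\mathbb{R}^m_+\}$. For $kl\in B$, $(P_{|kl})$ is $(P)$ with the additional constraint $x_{kl}=1$, with optimal value $z^*_{|kl}$. Feasibility (standing assumption): every pair of $B$ belongs to at least one support of $C$; hence $(P)$, $(D)$ and all $(P_{|kl})$ are feasible and bounded. For feasible $u$ of $(D)$ the reduced cost of $kl$ is $r_{kl}(u)=c_{kl}-uA_{kl}$. $R_{kl}=z^*_{|kl}-z^*$. A family $\{u^t\}_{t\in\mathcal{T}}$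 of optimal solutions of $(D)$ is complete if for every $kl\in B$ there is $t\in\mathcal{T}$ with $r_{kl}(u^t)=R_{kl}$. *)

(* Defs.v *)
From HB Require Import structures.
From mathcomp Require Export all_boot all_order all_algebra finmap.
From mathcomp Require Export boolp classical_sets reals.

Set Implicit Arguments.
Unset Strict Implicit.
Unset Printing Implicit Defensive.

Import Order.TTheory GRing.Theory Num.Theory.
Local Open Scope classical_set_scope.
Local Open Scope ring_scope.

(* The least element of a set of reals, or 0 if there is none. Under the
   standing assumptions a least element exists for all the linear programs below
   as soon as there is at least one variable/value pair. *)
Definition minval (R : realType) (V : set R) : R :=
  xget 0 [set z | V z /\ lbound V z].

Lemma minvalE (R : realType) (V : set R) (z : R) :
  V z -> lbound V z -> minval V = z.
Proof.
move=> Vz lbz; apply: (@xget_subset1 _ 0 [set z | V z /\ lbound V z] z) => //.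
by move=> x y [Vx lbx] [Vy lby]; apply/le_anti; rewrite lbx ?lby.
Qed.

Definition mxle (R : realType) (p q : nat) (M N : 'M[R]_(p, q)) : Prop :=
  forall i j, M i j <= N i j.

Definition conv_hull (R : realType) (p : nat) (S : set 'cV[R]_p) :
    set 'cV[R]_p :=
  [set x | exists k (w : 'I_k -> R) (s : 'I_k -> 'cV[R]_p),
     [/\ forall i, 0 <= w i, \sum_i w i = 1, forall i, S (s i)
       & x = \sum_i w i *: s i]].

Section Constraint.
Variables (n : nat) (D : 'I_n -> {fset int}) (C : set (n.-tuple int)).

(* The set B: the pair ij has [tag = i] and [tagged = j]. Vectors and matrices
   are indexed by B through [enum_rank]/[enum_val]. *)
Definition varval : finType := {i : 'I_n & D i}.

Definition var_of (p : varval) : 'I_n := tag p.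
Definition val_of (p : varval) : int := fsval (tagged p).

Definition support (a : n.-tuple int) : Prop :=
  C a /\ forall i, tnth a i \in D i.

Definition charvec (R : realType) (a : n.-tuple int) : 'cV[R]_#|varval| :=
  \col_p (tnth a (var_of (enum_val p)) == val_of (enum_val p))%:R.

Definition charvecs (R : realType) : set 'cV[R]_#|varval| :=
  [set x | exists2 a, support a & x = charvec R a].

Definition all_pairs_supported : Prop :=
  forall p : varval, exists2 a, support a & tnth a (var_of p) = val_of p.

End Constraint.

Section LinearPrograms.
Variables (R : realType) (n : nat) (D : 'I_n -> {fset int}) (m : nat).
Let B := varval D.
Variables (A : 'M[R]_(m, #|B|)) (b : 'cV[R]_m) (c : B -> int).

Definition primal_feasible : set 'cV[R]_#|B| :=
  [set x | mxle b (A *m x) /\ mxle 0 x].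

Definition ideal_formulation (C : set (n.-tuple int)) : Prop :=
  primal_feasible = conv_hull (@charvecs n D C R).

Definition cost : 'rV[R]_#|B| := \row_p (c (enum_val p))%:~R.

Definition primal_value : R :=
  minval [set (cost *m x) 0 0 | x in primal_feasible].

Definition primal_value_at (p : B) : R :=
  minval [set (cost *m x) 0 0 |
           x in primal_feasible `&` [set x | x (enum_rank p) 0 = 1]].

Definition dual_feasible (u : 'rV[R]_m) : Prop :=
  mxle (u *m A) cost /\ mxle 0 u.

Definition dual_optimal (u : 'rV[R]_m) : Prop :=
  dual_feasible u /\
  forall v, dual_feasible v -> (v *m b) 0 0 <= (u *m b) 0 0.

Definition reduced_cost (u : 'rV[R]_m) (p : B) : R :=
  (c p)%:~R - (u *m col (enum_rank p) A) 0 0.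

Definition cost_increase (p : B) : R := primal_value_at p - primal_value.

Definition complete_family (T : Type) (u : T -> 'rV[R]_m) : Prop :=
  (forall t, dual_optimal (u t)) /\
  (forall p : B, exists t, reduced_cost (u t) p = cost_increase p).

End LinearPrograms.

(* Main.v *)
(** Fix a variable X_i and lower each cost c_ij by R_ij >= 0. A support contains exactly one pair ij, and its
    cost was at least z*_|ij = z* + R_ij, so the lowered program still has value
    at least z*. By LP duality some u >= 0 satisfies ub >= z* and uA below the
    lowered costs: u is optimal in (D) and r_ij(u) >= R_ij for all j, while
    r_ij(u) <= R_ij holds for every optimal u. *)
Require Import Defs.
From mathcomp Require Import lra.

Set Implicit Arguments.
Unset Strict Implicit.
Unset Printing Implicit Defensive.

Import Order.TTheory GRing.Theory Num.Theory.
Local Open Scope classical_set_scope.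
Local Open Scope ring_scope.

(** * Linear inequalities and Farkas' lemma *)

Section LinearInequalities.
Variable R : realType.

Lemma mxle_mul2l (p q r : nat) (u : 'M[R]_(p, q)) (M N : 'M[R]_(q, r)) :
  mxle 0 u -> mxle M N -> mxle (u *m M) (u *m N).
Proof.
move=> u0 MN i j; rewrite !mxE; apply: ler_sum => k _.
by apply: ler_wpM2l => //; have := u0 i k; rewrite mxE.
Qed.

Lemma mxle_mul2r (p q r : nat) (x : 'M[R]_(q, r)) (M N : 'M[R]_(p, q)) :
  mxle 0 x -> mxle M N -> mxle (M *m x) (N *m x).
Proof.
move=> x0 MN i j; rewrite !mxE; apply: ler_sum => k _.
by apply: ler_wpM2r => //; have := x0 k j; rewrite mxE.
Qed.

Lemma mxle_col_mx0 (p q r : nat) (M : 'M[R]_(p, r)) (N : 'M[R]_(q, r)) :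
  mxle 0 (col_mx M N) <-> mxle 0 M /\ mxle 0 N.
Proof.
split=> [H|[HM HN] i j].
  split=> i j; [have := H (lshift _ i) j|have := H (rshift _ i) j];
    by rewrite ?col_mxEu ?col_mxEd !mxE.
rewrite mxE -(splitK i); case: (split i) => k /=.
  by rewrite col_mxEu; have := HM k j; rewrite mxE.
by rewrite col_mxEd; have := HN k j; rewrite mxE.
Qed.

(* Bartl's induction on the number of rows: if the first row cannot be dropped,
   project onto its kernel along a point that violates the conclusion. *)
Lemma farkas (m p : nat) (M : 'M[R]_(m, p)) (d : 'rV[R]_p) :
  (forall x : 'cV[R]_p, mxle 0 (M *m x) -> 0 <= (d *m x) 0 0) ->
  exists2 y : 'rV[R]_m, mxle 0 y & y *m M = d.
Proof.
elim: m M d => [|m IH]; last rewrite -[m.+1]/(1 + m)%N; move=> M d H.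
  exists 0; first by move=> i j; rewrite lexx.
  have d0 (x : 'cV[R]_p) : 0 <= (d *m x) 0 0 by apply: H => -[].
  (* With no rows every [x] is admissible; testing a unit vector and its negative forces [d = 0]. *)
  apply/rowP => j; rewrite mul0mx mxE; apply/le_anti/andP; split.
    by have := d0 (delta_mx j 0); rewrite -colE mxE.
  by have := d0 (- delta_mx j 0); rewrite mulmxN -colE !mxE oppr_ge0.
rewrite -[M]vsubmxK in H *.
move: (usubmx _) (dsubmx _) H => a {}M H.
have [H'|] := pselect (forall x : 'cV[R]_p,
    mxle 0 (M *m x) -> 0 <= (d *m x) 0 0).
  have [y y0 yM] := IH _ _ H'.
  exists (row_mx 0 y); last by rewrite mul_row_col mul0mx add0r.
  move=> i j; rewrite mxE -(splitK j); case: (split j) => k /=.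
    by rewrite row_mxEl mxE.
  by rewrite row_mxEr; have := y0 i k; rewrite mxE.
move=> /existsNP[x0 /not_implyP[Mx0 /negP]]; rewrite -ltNge => dx0.
(* [x0] satisfies the remaining rows but has [d *m x0] negative, so by [H] it must violate the first
   row. *)
have ax0 : (a *m x0) 0 0 < 0.
  rewrite ltNge; apply/negP => ax0.
  suff : 0 <= (d *m x0) 0 0 by rewrite leNgt dx0.
  apply: H; rewrite mul_col_mx; apply/mxle_col_mx0; split=> // i j.
  by rewrite !ord1 mxE.
pose t := (a *m x0) 0 0.
have tE : a *m x0 = t%:M by rewrite [LHS]mx11_scalar.
have t0 : t != 0 by rewrite lt_eqF.
pose P := 1%:M - t^-1 *: (x0 *m a).
have aP : a *m P = 0.
  rewrite mulmxBr mulmx1 -scalemxAr mulmxA tE mul_scalar_mx scalerA mulVf//.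
  by rewrite scale1r subrr.
(* Since [a *m P = 0], a point [P *m x] satisfies the first row with equality, so [H] applies once
   [M *m P *m x] is nonnegative. *)
have [|y y0 yMP] := IH (M *m P) (d *m P).
  move=> x; rewrite -!mulmxA => MPx; apply: H.
  rewrite mul_col_mx; apply/mxle_col_mx0; split => //.
  by rewrite mulmxA aP mul0mx => i j.
(* [(d - y *m M) *m P = 0] unfolds to [d - y *m M = l *: a] for this [l]. It is nonnegative because
   [t < 0] and [(d - y *m M) *m x0 <= d *m x0 < 0]. *)
pose l := t^-1 * ((d - y *m M) *m x0) 0 0.
exists (row_mx l%:M y).
  move=> i j; rewrite mxE -(splitK j); case: (split j) => k /=.
    rewrite row_mxEl !ord1 [l%:M _ _]mxE eqxx mulr1n /l mulmxBl.
    rewrite [X in _ * X]mxE [(- (_ *m _)) _ _]mxE.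
    rewrite mulr_le0 ?invr_le0 ?(ltW ax0)// subr_le0 (le_trans (ltW dx0))//.
    have := mxle_mul2l y0 Mx0 0 0; rewrite mulmx0 mxE mulmxA.
    by rewrite [X in _ <= X]mxE.
  by rewrite row_mxEr; have := y0 i k; rewrite mxE.
rewrite mul_row_col; move: yMP; rewrite /P mulmxA !mulmxBr !mulmx1 -!scalemxAr.
rewrite !mulmxA => /eqP; rewrite -subr_eq0 => /eqP E.
suff -> : l%:M *m a = t^-1 *: ((d - y *m M) *m x0 *m a).
  apply/eqP; rewrite -subr_eq0 -E !mulmxBl scalerBr; apply/eqP/rowP => j.
  by rewrite !mxE; lra.
rewrite [(d - _) *m x0]mx11_scalar mul_scalar_mx mul_scalar_mx.
by rewrite scalerA.
Qed.

(** Homogenize with an extra coordinate [t]: apply [farkas] to the cone [A x >= t b], [x >= 0],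
    [t >= 0] and the functional [c x - z t]. The multipliers of the first block form [u]. *)
Lemma affine_farkas (m p : nat) (A : 'M[R]_(m, p)) (b : 'cV[R]_m)
    (c : 'rV[R]_p) (z : R) (x0 : 'cV[R]_p) :
  mxle b (A *m x0) -> mxle 0 x0 ->
  (forall x : 'cV[R]_p, mxle b (A *m x) -> mxle 0 x -> z <= (c *m x) 0 0) ->
  exists u : 'rV[R]_m, [/\ mxle 0 u, mxle (u *m A) c & z <= (u *m b) 0 0].
Proof.
move=> Ax0 x00 H.
pose M : 'M[R]_(m + (p + 1), p + 1) := col_mx (row_mx A (- b)) 1%:M.
pose d : 'rV[R]_(p + 1) := row_mx c (- z%:M).
have [|y y0] := @farkas _ _ M d.
  move=> xt; rewrite -[xt]vsubmxK; move: (usubmx _) (dsubmx _) => x s.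
  rewrite mul_col_mx mul1mx !mul_row_col !mulNmx.
  move=> /mxle_col_mx0[Ax /mxle_col_mx0[x_ge0 s_ge0]].
  pose t := s 0 0.
  have sE : s = t%:M by rewrite [LHS]mx11_scalar.
  have t_ge0 : 0 <= t by have := s_ge0 0 0; rewrite mxE.
  rewrite -/t in sE; rewrite sE -scalar_mxM [X in _ <= X]mxE.
  rewrite [(- (z * t)%:M) _ _]mxE [(z * t)%:M _ _]mxE eqxx mulr1n subr_ge0.
  have {}Ax i : t * b i 0 <= (A *m x) i 0.
    have := Ax i 0; rewrite sE mul_mx_scalar mxE [X in _ <= X]mxE.
    by rewrite [(- (t *: b)) _ _]mxE [(t *: b) _ _]mxE subr_ge0.
  have {}x_ge0 i : 0 <= x i 0 by have := x_ge0 i 0; rewrite mxE.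
  have [t0|t_neq0] := eqVneq t 0.
    (* a recession direction: move from x0 along it *)
    rewrite t0 mulr0 leNgt; apply/negP => cx.
    (* This step length brings the cost down to exactly [z - 1], contradicting the bound [z]. *)
    pose k := ((c *m x0) 0 0 - z + 1) / - (c *m x) 0 0.
    have zx0 := H _ Ax0 x00.
    have k0 : 0 <= k by apply: divr_ge0; lra.
    suff : z <= (c *m (x0 + k *: x)) 0 0.
      rewrite mulmxDr -scalemxAr mxE [X in _ + X]mxE.
      have -> : k * (c *m x) 0 0 = - ((c *m x0) 0 0 - z + 1).
        by rewrite /k invrN mulrN mulNr divfK// lt_eqF.
      lra.
    apply: H => i j; rewrite ord1.
      rewrite mulmxDr -scalemxAr [X in _ <= X]mxE [X in _ + X]mxE.
      apply: (le_trans (Ax0 i 0)); rewrite lerDl mulr_ge0//.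
      by have := Ax i; rewrite t0 mul0r.
    rewrite !mxE; apply: addr_ge0; last exact: mulr_ge0 (x_ge0 i).
    by have := x00 i 0; rewrite mxE.
  have t_gt0 : 0 < t by rewrite lt_neqAle eq_sym t_neq0.
  (* For [t > 0], rescaling to [t = 1] gives a point of the original polyhedron. *)
  suff : z <= (c *m (t^-1 *: x)) 0 0.
    by rewrite -scalemxAr [X in _ <= X]mxE ler_pdivlMl// mulrC.
  apply: H => i j; rewrite ord1.
    by rewrite -scalemxAr [X in _ <= X]mxE ler_pdivlMl.
  by rewrite !mxE mulr_ge0// invr_ge0.
move: y0; rewrite -[y]hsubmxK; move: (lsubmx y) (rsubmx y) => u v y0.
rewrite mul_row_col mulmx1 mul_mx_row -[v]hsubmxK add_row_mx.
(* [v1] and [v2] are nonnegative slacks: [u A + v1 = c] and [v2 - u b = - z]. *)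
move: (lsubmx v) (rsubmx v) (hsubmxK v) => v1 v2 vE /eq_row_mx[E1 E2].
exists u; split.
- by move=> i j; have := y0 i (lshift _ j); rewrite row_mxEl !mxE.
- move=> i j; rewrite -E1 [X in _ <= X]mxE lerDl.
  by have := y0 i (rshift _ (lshift _ j)); rewrite row_mxEr -vE row_mxEl mxE.
- have := y0 0 (rshift _ (rshift _ 0)); rewrite row_mxEr -vE row_mxEr mxE.
  move/matrixP/(_ 0 0): E2; rewrite mulmxN mxE.
  rewrite [(- (u *m b)) _ _]mxE [(- z%:M) _ _]mxE [z%:M _ _]mxE eqxx mulr1n.
  by move=> E ?; lra.
Qed.

(** * Linear functionals on convex hulls, and attained minima *)

Lemma conv_hull_ge (p : nat) (S : set 'cV[R]_p) (l : 'rV[R]_p) (z : R) :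
  (forall s, S s -> z <= (l *m s) 0 0) ->
  forall x, conv_hull S x -> z <= (l *m x) 0 0.
Proof.
move=> H x [k [w [s [w0 w1 Ss ->]]]].
rewrite mulmx_sumr summxE -[z]mul1r -w1 mulr_suml; apply: ler_sum => i _.
by rewrite -scalemxAr mxE ler_wpM2l ?H.
Qed.

(* A convex combination with maximal coordinate only involves generators with
   that coordinate maximal. *)
Lemma conv_hull_face_ge (p : nat) (S : set 'cV[R]_p) (l : 'rV[R]_p) (z : R)
    (q : 'I_p) :
  (forall s, S s -> s q 0 <= 1) ->
  (forall s, S s -> s q 0 = 1 -> z <= (l *m s) 0 0) ->
  forall x, conv_hull S x -> x q 0 = 1 -> z <= (l *m x) 0 0.
Proof.
move=> S1 H x [k [w [s [w0 w1 Ss ->]]]].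
rewrite summxE => E.
have {}E : \sum_i w i * (1 - s i q 0) = 0.
  under eq_bigr do rewrite mulrBr mulr1.
  rewrite sumrB w1 -[X in X - _]E; apply/eqP; rewrite subr_eq0; apply/eqP.
  by apply: eq_bigr => i _; rewrite mxE.
have {}E : forall i, true -> w i * (1 - s i q 0) = 0.
  by apply: psumr_eq0P E => i _; rewrite mulr_ge0// subr_ge0 S1.
rewrite mulmx_sumr summxE -[z]mul1r -w1 mulr_suml; apply: ler_sum => i _.
rewrite -scalemxAr [X in _ <= X]mxE.
have /eqP := E i isT; rewrite mulf_eq0 => /orP[/eqP->|]; first by rewrite !mul0r.
by rewrite subr_eq0 => /eqP s1; rewrite ler_wpM2l ?H.
Qed.

(** [T] may be infinite, as integer tuples are; the minimum is attained because the objective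
    factors through the finite type [F]. *)
Lemma finite_range_min (T : Type) (F : finType) (e : T -> F) (g : F -> R)
    (P : T -> Prop) :
  (exists a, P a) ->
  exists2 a, P a & forall a', P a' -> g (e a) <= g (e a').
Proof.
move=> [a0 Pa0]; pose Q f := `[< exists2 a, P a & e a = f >].
have Q0 : Q (e a0) by apply/asboolP; exists a0.
have [f /asboolP[a Pa <-] fmin] := Order.TotalTheory.arg_minP g Q0.
by exists a => // a' Pa'; apply: fmin; apply/asboolP; exists a'.
Qed.

Lemma minval_least (V : set R) (z : R) :
  V z -> lbound V z -> V (minval V) /\ lbound V (minval V).
Proof. by move=> Vz lbz; rewrite (minvalE Vz lbz). Qed.

End LinearInequalities.

(** * The programs (P), (P|kl) and (D) of the constraint *)

Lemma varval_inj (n : nat) (D : 'I_n -> {fset int}) (p q : varval D) :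
  var_of p = var_of q -> val_of p = val_of q -> p = q.
Proof.
case: p q => [i x] [j y]; rewrite /var_of /val_of /= => ij; subst j.
by move=> /val_inj->.
Qed.

Section Duality.
Variables (R : realType) (n : nat) (D : 'I_n -> {fset int}).
Variables (C : set (n.-tuple int)) (m : nat).
Variables (A : 'M[R]_(m, #|varval D|)) (b : 'cV[R]_m) (c : varval D -> int).
Hypothesis hideal : ideal_formulation A b C.

Lemma charvec_feasible (a : n.-tuple int) :
  support D C a -> primal_feasible A b (charvec D R a).
Proof.
move=> sa; rewrite hideal; exists 1%N, (fun=> 1), (fun=> charvec D R a); split.
- by move=> _; exact: ler01.
- by rewrite big_ord1.
- by move=> _; exists a.
- by rewrite big_ord1 scale1r.
Qed.

Lemma charvec_min (l : 'rV[R]_#|varval D|) (P : n.-tuple int -> Prop) :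
  (exists a, P a) ->
  exists2 a, P a & forall a', P a' ->
    (l *m charvec D R a) 0 0 <= (l *m charvec D R a') 0 0.
Proof.
(* The incidence pattern of a tuple on the finite set of pairs determines its characteristic
   vector. *)
pose e (a : n.-tuple int) := [ffun p : varval D => tnth a (var_of p) == val_of p].
pose g (f : {ffun varval D -> bool}) :=
  (l *m \col_p (f (enum_val p))%:R) 0 0 : R.
have chE a : g (e a) = (l *m charvec D R a) 0 0.
  by congr ((l *m _) 0 0); apply/colP => p; rewrite !mxE ffunE.
move=> /(finite_range_min e g)[a Pa amin]; exists a => // a' Pa'.
by rewrite -!chE amin.
Qed.

(** A cheapest support attains the minimum over the hull, so [primal_value] is not the default of
    [minval]. *)
Lemma primal_valueP :
  (exists a, support D C a) ->
  [set (cost R c *m x) 0 0 | x in primal_feasible A b] (primal_value A b c) /\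
  lbound [set (cost R c *m x) 0 0 | x in primal_feasible A b]
    (primal_value A b c).
Proof.
move=> /(charvec_min (cost R c))[a sa amin].
apply: (@minval_least _ _ ((cost R c *m charvec D R a) 0 0)).
  by exists (charvec D R a) => //; exact: charvec_feasible.
move=> _ [x xf <-]; rewrite hideal in xf; move: x xf.
by apply: conv_hull_ge => _ [a' sa' ->]; exact: amin.
Qed.

(** Characteristic vectors have entries at most 1, so a hull point with entry 1 at [p] combines only
    supports through [p]; a cheapest such support is optimal. *)
Lemma primal_value_atP (p : varval D) :
  (exists2 a, support D C a & tnth a (var_of p) = val_of p) ->
  let V := [set (cost R c *m x) 0 0 | x in primal_feasible A b `&`
              [set x | x (enum_rank p) 0 = 1]] in
  V (primal_value_at A b c p) /\ lbound V (primal_value_at A b c p).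
Proof.
have chE a : tnth a (var_of p) = val_of p <->
    charvec D R a (enum_rank p) 0 = 1.
  rewrite mxE enum_rankK; split=> [->|]; first by rewrite eqxx.
  by case: eqP => // _; rewrite /= mulr0n => /esym/eqP; rewrite oner_eq0.
move=> [a0 sa0 a0p] V.
have [|a [sa ap] amin] := @charvec_min (cost R c)
    (fun a => support D C a /\ tnth a (var_of p) = val_of p); first by exists a0.
apply: (@minval_least _ _ ((cost R c *m charvec D R a) 0 0)).
  exists (charvec D R a) => //; split; first exact: charvec_feasible.
  exact/chE.
move=> _ [x [xf xp] <-]; rewrite hideal in xf; move: x xf xp.
apply: conv_hull_face_ge => _ [a' sa' ->].
  by rewrite mxE; case: eqP; rewrite ?lexx ?ler01.
by move=> /chE a'p; apply: amin.
Qed.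

Lemma weak_duality (u : 'rV[R]_m) (x : 'cV[R]_#|varval D|) :
  dual_feasible A c u -> primal_feasible A b x ->
  (u *m b) 0 0 <= (cost R c *m x) 0 0.
Proof.
move=> [uA u0] [Ax x0]; apply: le_trans (mxle_mul2l u0 Ax 0 0) _.
by rewrite mulmxA; exact: mxle_mul2r.
Qed.

Lemma reduced_costE (u : 'rV[R]_m) (p : varval D) :
  reduced_cost A c u p = (cost R c - u *m A) 0 (enum_rank p).
Proof.
rewrite /reduced_cost !mxE enum_rankK; congr (_ - _).
by apply: eq_bigr => j _; rewrite mxE.
Qed.

(** Take [x] optimal for (P|kl) and write [c x = (c - u A) x + u (A x)]. The first term is at least
    the reduced cost of [p], since [x] is 1 there; the second is at least [u b], hence at least
    z*. *)
Lemma reduced_cost_le (u : 'rV[R]_m) (p : varval D) :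
  (exists2 a, support D C a & tnth a (var_of p) = val_of p) ->
  dual_feasible A c u -> primal_value A b c <= (u *m b) 0 0 ->
  reduced_cost A c u p <= cost_increase A b c p.
Proof.
move=> ap [uA u0] ub.
have [[x [[Ax x0] /= xp] xE] _] := primal_value_atP ap.
rewrite /cost_increase lerBrDr -xE reduced_costE.
have -> : cost R c *m x = (cost R c - u *m A) *m x + u *m (A *m x).
  by rewrite mulmxBl mulmxA subrK.
rewrite [X in _ <= X]mxE lerD//; last first.
  exact: le_trans ub (mxle_mul2l u0 Ax 0 0).
rewrite [X in _ <= X]mxE (bigD1 (enum_rank p))//= xp mulr1 lerDl.
apply: sumr_ge0 => q _; apply: mulr_ge0; last by have := x0 q 0; rewrite mxE.
by rewrite mxE [X in _ + X]mxE subr_ge0; exact: uA.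
Qed.

Lemma dual_optimal_tight_at_variable (i : 'I_n) :
  (exists a, support D C a) -> all_pairs_supported D C ->
  exists2 u : 'rV[R]_m, dual_optimal A b c u &
    forall p, var_of p = i -> reduced_cost A c u p = cost_increase A b c p.
Proof.
move=> suppC hsupp.
have [[x xf xE] zmin] := primal_valueP suppC.
have inc_ge0 p : 0 <= cost_increase A b c p.
  rewrite subr_ge0; have [[y [yf _] <-] _] := primal_value_atP (hsupp p).
  by apply: zmin; exists y.
pose d : 'rV[R]_#|varval D| := \row_q
  (if var_of (enum_val q) == i then cost_increase A b c (enum_val q) else 0).
have d_ge0 q : 0 <= d 0 q by rewrite mxE; case: ifP.
have [y Ay y0|u [u0 uA zu]] := @affine_farkas _ _ _ A b (cost R c - d)
    (primal_value A b c) x xf.1 xf.2.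
  have : primal_feasible A b y by [].
  rewrite hideal; apply: conv_hull_ge => _ [a sa ->].
  (* The only pair of variable [i] in the support [a], so lowering the costs by [d] lowers the cost
     of [a] by exactly [cost_increase A b c p]. *)
  pose p : varval D := Tagged (fun j => D j) [` sa.2 i]%fset.
  have dE : (d *m charvec D R a) 0 0 = cost_increase A b c p.
    rewrite mxE (bigD1 (enum_rank p))//= !mxE enum_rankK !eqxx mulr1.
    rewrite big1 ?addr0// => q qp; rewrite !mxE.
    case: eqP => [qi|_]; last by rewrite mul0r.
    case: eqP => [qa|_]; last by rewrite mulr0.
    case/eqP: qp; apply: enum_val_inj; rewrite enum_rankK.
    by apply: varval_inj => //; rewrite -qa qi.
  rewrite mulmxBl [X in _ <= X]mxE [X in _ + X]mxE dE lerBrDr.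
  rewrite addrC subrK.
  apply: (primal_value_atP (hsupp p)).2; exists (charvec D R a) => //.
  split; first exact: charvec_feasible.
  by rewrite /= mxE enum_rankK eqxx.
(* As [d >= 0], feasibility for the lowered costs implies feasibility for [c]. *)
have uf : dual_feasible A c u.
  split=> // k q; apply: le_trans (uA k q) _.
  by rewrite !ord1 [X in X <= _]mxE [(- d) _ _]mxE gerBl.
exists u.
  split=> // v vf; apply: le_trans zu; rewrite -xE; exact: weak_duality.
move=> p pi; apply/le_anti; rewrite reduced_cost_le//=.
have dE : d 0 (enum_rank p) = cost_increase A b c p.
  by rewrite mxE enum_rankK pi eqxx.
have := uA 0 (enum_rank p); rewrite reduced_costE.
rewrite [(cost R c - d) _ _]mxE [(cost R c - u *m A) _ _]mxE.
rewrite [(- d) _ _]mxE [(- (u *m A)) _ _]mxE dE; lra.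
Qed.
End Duality.

Theorem mainTheorem8 (R : realType) (n : nat) (D : 'I_n -> {fset int})
    (C : set (n.-tuple int)) (m : nat)
    (A : 'M[R]_(m, #|varval D|)) (b : 'cV[R]_m) (c : varval D -> int)
    (hideal : ideal_formulation A b C)
    (hsupp : all_pairs_supported D C) :
  exists (k : nat) (u : 'I_k -> 'rV[R]_m),
    (k <= n)%N /\ complete_family A b c u.
Proof.
have [[p0 _]|noB] := pselect (exists p : varval D, True); last first.
  (* Without pairs no support is guaranteed, so (D) may lack an optimum; the empty family is
     vacuously complete. *)
  exists 0%N, (fun=> 0); split=> //; split=> [[]//|p].
  by case: noB; exists p.
have suppC : exists a, support D C a by have [a sa _] := hsupp p0; exists a.
have H i := cid2 (dual_optimal_tight_at_variable c hideal i suppC hsupp).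
(* One dual optimum per variable; a pair is served by the member of its own variable. *)
exists n, (fun i => projT1 (H i)); split=> //; split=> [i|p].
  by case: (H i).
by exists (var_of p); case: (H (var_of p)) => u /= _; apply.
Qed.
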